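(* Let $k\ge 1$ and $n\ge 1$ be integers. Then $c(n,k)=0$ for $n\le k-1$; $c(n,k)=2$ for $n=k$ and $n=k+1$; and, for $n\ge k+2$, $$ \begin{aligned} c(n,k) \;=\;& 2\,c(n-1,k) \\ &+\,[k\mid n]\,\left(p'\!\left(\tfrac{n}{k},k-1\right)+q\!\left(\tfrac{n}{k},k-2\right)\right)\\ &-\,[k+1\mid n]\,\left(p'\!\left(\tfrac{n}{k+1},k\right)+q\!\left(\tfrac{n}{k+1},k-1\right)\right), \end{aligned} $$ where the Iverson bracket $[R]$ is $1$ if the relation $R$ is true and $0$ otherwise (a term whose bracket is $0$ is taken to be $0$).
   Context: All sequences here are finite nonempty sequences with terms in $\{2,3\}$ (binary sequences). Juxtaposition is concatenation, and $Y^k$ is $Y$ repeated $k$ times. The curling number $\mathrm{cn}(S)$ of $S$ is the largest integer $k\ge 1$ such that $S=XY^k$ for some (possibly empty) sequence $X$ and some nonempty sequence $Y$. $c(n,k)$ is the number of binary sequences of length $n$ with curling number $k$. A sequence $S$ is primitive if it is not equal to $T^i$ for any sequence $T$ and integer $i\ge 2$. For $1\le k\le n$, $\mathcal{P}(n,k)$ is the set of primitive binary sequences of length $n$ and curling number $k$, and $p(n,k)=\#\mathcal{P}(n,k)$. For $1\le k\le n$, $q(n,k)=\sum_{i=1}^{k}p(n,i)$ is the number of primitive binary sequences of length $n$ with curling number at most $k$; also $q(n,0)=0$ and $q(n,k)=q(n,n)$ for $k>n$. A sequence $S\in\mathcal{P}(n,k)$ is robust if no proper suffix of $S^{k+1}$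 has curling number $\ge k+1$. For $1\le k\le n$, $p'(n,k)$ is the number of robust $S\in\mathcal{P}(n,k)$. Conventions at the boundary: $p'(m,0)=0$, $p'(m,k)=0$ for $k>m$, and $q(m,-1)=0$. *)

(* Defs.v *)
From mathcomp Require Import all_boot.

Set Implicit Arguments.
Unset Strict Implicit.
Unset Printing Implicit Defensive.

Section Sequences.

Variable T : eqType.
Implicit Types (S X Y : seq T) (k n : nat).

Definition power k S : seq T := flatten (nseq k S).

Lemma size_power k S : size (power k S) = k * size S.
Proof. by rewrite /power size_flatten /shape map_nseq sumn_nseq mulnC. Qed.

(* X ranges over the prefixes of S, and Y over the nonempty prefixes of what
   follows X; see [curlsP]. *)
Definition curls S k : bool :=
  [exists i : 'I_(size S).+1, [exists l : 'I_(size S).+1,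
     (0 < l <= size S - i) &&
     (S == take i S ++ power k (take l (drop i S)))]].

Lemma curlsP S k : 0 < k ->
  reflect (exists X Y, Y <> [::] /\ S = X ++ power k Y) (curls S k).
Proof.
move=> k_gt0; apply: (iffP existsP).
  case=> i /existsP[l /andP[/andP[l0 lS] /eqP defS]].
  exists (take i S), (take l (drop i S)); split=> // Y0.
  have: size (take l (drop i S)) = l by rewrite size_takel ?size_drop.
  by rewrite Y0 /= => l_eq; rewrite -l_eq in l0.
case=> X [Y [Y0 defS]].
have Ygt0 : 0 < size Y by case: Y Y0 defS.
have szS : size S = size X + k * size Y by rewrite defS size_cat size_power.
have leYk : size Y <= k * size Y by rewrite leq_pmull.
have ltX : size X < (size S).+1 by rewrite ltnS szS leq_addr.
have ltY : size Y < (size S).+1.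
  by rewrite ltnS szS (leq_trans leYk) ?leq_addl.
exists (Ordinal ltX); apply/existsP; exists (Ordinal ltY) => /=.
rewrite Ygt0 szS addKn leYk /= {1 2 3}defS take_size_cat // drop_size_cat //.
by case: k k_gt0 {defS szS leYk ltX ltY} => // k _; rewrite /power /= take_size_cat.
Qed.

(* The curling number; see [cnP]. The empty sequence gets the value 0. *)
Definition cn S : nat := \max_(k < (size S).+1 | (0 < k) && curls S k) k.

Lemma curls_leq_size S k : 0 < k -> curls S k -> k <= size S.
Proof.
move=> k_gt0 /(curlsP S k_gt0)[X [Y [Y0 ->]]].
rewrite size_cat size_power (leq_trans _ (leq_addl _ _)) // leq_pmulr //.
by case: Y Y0.
Qed.

Lemma cnP S : S <> [::] ->
  [/\ 0 < cn S,
      exists X Y, Y <> [::] /\ S = X ++ power (cn S) Y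
    & forall k X Y, 0 < k -> Y <> [::] -> S = X ++ power k Y -> k <= cn S].
Proof.
move=> S0.
have max_cn k : 0 < k -> curls S k -> k <= cn S.
  move=> k0 ck; have lt_k : k < (size S).+1 by rewrite ltnS curls_leq_size.
  by apply: (leq_bigmax_cond (Ordinal lt_k)); rewrite /= k0.
have c1 : curls S 1.
  by apply/curlsP=> //; exists [::], S; rewrite /power /= cats0.
have cn0 : 0 < cn S by apply: max_cn.
split=> //; last first.
  by move=> k X Y k0 Y0 defS; apply: max_cn => //; apply/curlsP=> //; exists X, Y.
apply/curlsP => //.
have [k /andP[_ ck] ->] : {k : 'I_(size S).+1 |
    (k \in [pred k : 'I_(size S).+1 | (0 < k) && curls S k]) & cn S = k}.
  apply: eq_bigmax_cond; apply/card_gt0P.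
  have lt1 : 1 < (size S).+1 by rewrite ltnS; case: S S0 {max_cn c1 cn0}.
  by exists (Ordinal lt1); rewrite inE.
exact: ck.
Qed.

(* Only meant for nonempty sequences; see [primitiveP]. *)
Definition primitive S : bool :=
  ~~ [exists i : 'I_(size S).+1, [exists l : 'I_(size S).+1,
        (1 < i) && (S == power i (take l S))]].

Lemma primitiveP S : S <> [::] ->
  reflect (~ exists X i, 1 < i /\ S = power i X) (primitive S).
Proof.
move=> S0; apply: (iffP negP) => H.
  case=> X [i [i1 defS]]; apply: H.
  have szS : size S = i * size X by rewrite defS size_power.
  have X0 : 0 < size X by case: X defS {szS} => // defS; case: S0; rewrite defS
    /power; elim: (i).
  have lti : i < (size S).+1 by rewrite ltnS szS leq_pmulr.
  have ltX : size X < (size S).+1 by rewrite ltnS szS leq_pmull // ltnW.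
  apply/existsP; exists (Ordinal lti); apply/existsP; exists (Ordinal ltX).
  rewrite /= i1 /=; apply/eqP; rewrite [in RHS]defS.
  by case: i i1 defS {szS lti ltX} => // i _ -> ; rewrite {3}/power /= take_size_cat.
case/existsP=> i /existsP[l /andP[i1 /eqP defS]]; apply: H.
by exists (take l S), i.
Qed.

(* Applied to primitive sequences S with curling number k. *)
Definition robust k S : bool :=
  [forall i : 'I_(size (power k.+1 S)).+1,
     (0 < i) ==> ~~ (k.+1 <= cn (drop i (power k.+1 S)))].

Lemma cn_nil : cn [::] = 0.
Proof. by rewrite /cn big1 // => i _; case: i => [[]]. Qed.

Lemma robustP k S :
  reflect (~ exists X W, [/\ X <> [::], W <> [::],
                             power k.+1 S = X ++ W & k.+1 <= cn W])
          (robust k S).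
Proof.
apply: (iffP forallP) => [H [X [W [X0 W0 defSk kW]]] | H i].
  have ltX : size X < (size (power k.+1 S)).+1.
    by rewrite ltnS defSk size_cat leq_addr.
  have := H (Ordinal ltX); rewrite /= defSk drop_size_cat // kW.
  by case: X X0 {defSk ltX}.
apply/implyP=> i0; apply/negP => ki; apply: H.
exists (take i (power k.+1 S)), (drop i (power k.+1 S)).
split; rewrite ?cat_take_drop //; last first.
  by move=> W0; rewrite W0 cn_nil in ki.
move/(congr1 size); rewrite size_takel; last by rewrite -ltnS.
by move=> /= i_eq; rewrite i_eq in i0.
Qed.

End Sequences.

Definition letter : finType := seq_sub [:: 2; 3].

Definition c (n k : nat) : nat := #|[set S : n.-tuple letter | cn S == k]|.

Definition P (n k : nat) : {set n.-tuple letter} :=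
  [set S : n.-tuple letter | primitive S & cn S == k].

Definition p (n k : nat) : nat := #|P n k|.

(* For k > n the additional terms vanish (see [q_gt]), and the sum is empty
   for k = 0. An index -1, where the count is 0 by convention, may be replaced
   by 0, so truncated subtraction can be used for the second argument. *)
Definition q (n k : nat) : nat := \sum_(1 <= i < k.+1) p n i.

Definition p' (n k : nat) : nat := #|[set S in P n k | robust k S]|.

Lemma p_out n k : 0 < n -> (k == 0) || (n < k) -> p n k = 0.
Proof.
move=> n0 kn; apply: eq_card0 => S; rewrite !inE; apply/negP.
case/andP=> _ /eqP cnS.
have S0 : tval S <> [::] by move/(congr1 size); rewrite size_tuple => /= n_eq;
  rewrite n_eq in n0.
have [cn0 [X [Y [Y0 defS]]] _] := cnP S0.
have : cn S <= size S.
  by apply: (curls_leq_size cn0); apply/curlsP => //; exists X, Y.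
rewrite size_tuple cnS leqNgt => /negbTE n_ge_k; move: kn.
by rewrite n_ge_k orbF => /eqP k0; rewrite cnS k0 in cn0.
Qed.

Lemma p'_out n k : 0 < n -> (k == 0) || (n < k) -> p' n k = 0.
Proof.
move=> n0 kn; apply/eqP; rewrite -leqn0 -(p_out n0 kn).
by apply: subset_leq_card; apply/subsetP=> S; rewrite inE => /andP[].
Qed.

Lemma q0 n : q n 0 = 0.
Proof. by rewrite /q big_geq. Qed.

Lemma q_gt n k : 0 < n -> n < k -> q n k = q n n.
Proof.
move=> n0 nk; rewrite /q (@big_cat_nat _ _ _ n.+1) //=; last exact: ltnW.
rewrite [X in _ + X]big_nat_cond [X in _ + X]big1 ?addn0 // => i.
by rewrite andbT => /andP[ni _]; rewrite p_out ?ni ?orbT.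
Qed.

(* Main.v *)
Require Import Defs.
From mathcomp Require Import all_boot all_order all_algebra.
From mathcomp Require Import zify.

(** Prepending a letter to a sequence leaves its curling number unchanged or
    raises it by exactly one, because a new repetition that was not already
    visible in the tail must use the whole sequence: it has the form [Y^(k+1)],
    and the tail still ends with [Y^k]. Let [jumps n k] count the sequences of
    length [n] with curling number [k+1] whose tail has curling number [k].
    Sorting the sequences of length [n+1] by the curling numbers of the
    sequence and of its tail gives ([c_recursion])

      c(n+1, k) = 2 c(n, k) + jumps(n+1, k-1) - jumps(n+1, k),

    so everything rests on the evaluation of [jumps].

    A sequence counted by [jumps n k] is [Y^(k+1)] with [Y] of length
    [m = n/(k+1)], hence there is none unless [k+1] divides [n]. Conversely,
    when [k > 0], the word [Y^(k+1)] is counted exactly when [Y] is primitive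
    (otherwise its curling number is too large) and its proper suffixes have
    curling number at most [k], which is robustness at level [k]
    ([jump_power]). Such a [Y] is a proper suffix of [Y^(k+1)], so its curling
    number is at most [k]. Those with curling number exactly [k] number
    [p' m k]; it remains to see that every primitive [Y] with a smaller curling
    number qualifies ([primitive_robust]), for they number [q m (k-1)].

    This is an argument of Fine and Wilf type. If [Z^(k+1)] is a proper suffix
    of [Y^(k+1)], then [Z] is shorter than [Y]; and [Z^k], which is not a suffix
    of [Y], is longer than [Y]. The two periods then overlap on a length
    [|Y| + |Z|], which forces [YZ = ZY]; commuting words are powers of a common
    word, and [Y] is not primitive.

    The values at [n = k] and [n = k+1] follow from the same recursion, since
    [jumps] at [n = k+1] counts the [(k+1)]-st powers of a single letter. *)

(** * Powers, suffixes and commuting words *)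

Section Words.

Variable T : eqType.
Implicit Types (S U V X Y Z W : seq T) (i j k m : nat).

Lemma powerD i j Y : power (i + j) Y = power i Y ++ power j Y.
Proof. by rewrite /power nseqD flatten_cat. Qed.

Lemma powerS k Y : power k.+1 Y = Y ++ power k Y.
Proof. by []. Qed.

Lemma power1 Y : power 1 Y = Y.
Proof. by rewrite powerS cats0. Qed.

Lemma powerSr k Y : power k.+1 Y = power k Y ++ Y.
Proof. by rewrite -addn1 powerD power1. Qed.

Lemma powerM i j Y : power i (power j Y) = power (i * j) Y.
Proof. by elim: i => // i IHi; rewrite powerS IHi mulSn powerD. Qed.

Lemma nonempty_size {Y} : (Y <> [::]) <-> 0 < size Y.
Proof. by case: Y. Qed.

Lemma suffix_size_inj X Y U V :
  X ++ U = Y ++ V -> size U = size V -> U = V.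
Proof.
move=> eqS eqU; have := congr1 size eqS; rewrite !size_cat eqU => /addIn eqX.
by move/eqP: eqS; rewrite eqseq_cat // => /andP[_ /eqP].
Qed.

Lemma suffix_suffix X Y U V :
  X ++ U = Y ++ V -> size U <= size V -> exists Z, V = Z ++ U.
Proof.
move=> eqS leUV; exists (take (size V - size U) V).
rewrite -{1}(cat_take_drop (size V - size U) V); congr (_ ++ _).
apply/esym; apply: (@suffix_size_inj X (Y ++ take (size V - size U) V)).
  by rewrite -catA cat_take_drop.
by rewrite size_drop; lia.
Qed.

(** Euclid's algorithm on the lengths: if [Z] is the shorter word, it is a
    prefix of [Y], and the rest of [Y] still commutes with [Z]. *)
Lemma commuting_words Y Z :
  Y ++ Z = Z ++ Y -> exists W i j, Y = power i W /\ Z = power j W.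
Proof.
have [m] := ubnP (size Y + size Z); elim: m Y Z => // m IHm Y Z.
wlog leZY : Y Z / size Z <= size Y => [IH ltm|].
  have [leZY|/ltnW leYZ] := leqP (size Z) (size Y); first exact: IH.
  move/esym/(IH Z Y leYZ); rewrite addnC => /(_ ltm)[W [i [j [-> ->]]]].
  by exists W, j, i.
case: (posnP (size Z)) => [/size0nil -> _ _|Z0 ltm eqYZ].
  by exists Y, 1, 0; rewrite power1.
have defY : Y = Z ++ drop (size Z) Y.
  have /eqP := congr1 (take (size Z)) eqYZ.
  rewrite take_cat take_size_cat //.
  case: ltnP => [_ /eqP defZ|leYZ _]; first by rewrite -{1}defZ cat_take_drop.
  (* Equal lengths: the two sides of [eqYZ] then match letter by letter. *)
  have eqsz : size Y = size Z by apply/eqP; rewrite eqn_leq leYZ.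
  rewrite drop_oversize // cats0.
  by have /eqP := eqYZ; rewrite eqseq_cat // => /andP[/eqP].
move: (drop _ _) defY => Y' defY; rewrite {}defY in eqYZ ltm leZY *.
have /eqP := eqYZ; rewrite -catA eqseq_cat // => /andP[_ /eqP eqY'Z].
have [|W [i [j [-> ->]]]] := IHm Y' Z _ eqY'Z.
  by move: ltm; rewrite size_cat; lia.
by exists W, (j + i), j; rewrite powerD.
Qed.

(** * Curling numbers of a sequence and of its tail *)

(** The values [k] for which a sequence ends with a [k]-th power form an initial
    segment, because [Y^j] is a suffix of [Y^(i+j)]. *)
Lemma leq_cnP {k S} : 0 < k ->
  reflect (exists X Y, Y <> [::] /\ S = X ++ power k Y) (k <= cn S).
Proof.
move=> k0; have [-> | Sn0] := eqVneq S [::].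
  rewrite cn_nil leqNgt k0; apply: ReflectF => -[X [Y [/nonempty_size Y0]]].
  by move/(congr1 size); rewrite size_cat size_power /=; nia.
have [_ defS maxS] := cnP (elimN eqP Sn0).
apply: (iffP idP) => [lek|[X [Y [Y0 defX]]]]; last exact: maxS defX.
case: defS => X [Y [Y0 defS]].
exists (X ++ power (cn S - k) Y), Y; split=> //.
by rewrite -catA -powerD subnK.
Qed.

Lemma cn_gt0 S : (0 < cn S) = (0 < size S).
Proof.
case: S => [|a S]; first by rewrite cn_nil.
by apply/leq_cnP=> //; exists [::], (a :: S); rewrite power1.
Qed.

Lemma cn_leq_size S : cn S <= size S.
Proof.
case: (posnP (cn S)) => [-> //|c0]; have /(leq_cnP c0) := leqnn (cn S).
case=> X [Y [/nonempty_size Y0 /(congr1 size)]].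
by rewrite size_cat size_power; nia.
Qed.

Lemma cn_suffix X S : cn S <= cn (X ++ S).
Proof.
case: (posnP (cn S)) => [-> //|c0]; have /(leq_cnP c0) := leqnn (cn S).
case=> Z [Y [Y0 defS]]; apply/(leq_cnP c0); exists (X ++ Z), Y.
by rewrite -catA -defS.
Qed.

Lemma cn_behead S : cn (behead S) <= cn S.
Proof. by case: S => // a S; apply: (cn_suffix [:: a]). Qed.

(** Were the repetition [Y^k] preceded by some letter, the tail would end with it
    as well. *)
Lemma cn_jump_power S k : cn (behead S) < k <= cn S ->
  exists2 Y, Y <> [::] & S = power k Y.
Proof.
case/andP=> ltk lek; have k0 := leq_ltn_trans (leq0n _) ltk.
case/(leq_cnP k0): lek => -[|a X] [Y [Y0 defS]]; first by exists Y.
suff : k <= cn (behead S) by rewrite leqNgt ltk.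
by apply/(leq_cnP k0); exists X, Y; rewrite defS.
Qed.

Lemma power_pred_behead k Y : Y <> [::] -> k <= cn (behead (power k.+1 Y)).
Proof.
case: k => // k; case: Y => // a Y _; apply/leq_cnP => //.
by exists Y, (a :: Y).
Qed.

(** A rise by two or more would make the sequence a power with exponent
    [cn (behead S) + 2], and removing one letter spoils only one of its
    factors. *)
Lemma cn_leq_behead S : cn S <= (cn (behead S)).+1.
Proof.
rewrite leqNgt; apply/negP => lt1.
have [|Y Y0 defS] := @cn_jump_power S (cn (behead S)).+2.
  by rewrite leqnSn.
by have := power_pred_behead (cn (behead S)).+1 _ Y0; rewrite -defS ltnn.
Qed.

(** * Robust words *)

Lemma power_gt1_not_primitive i W :
  power i W <> [::] -> 1 < i -> ~~ primitive (power i W).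
Proof. by move=> n0 i1; apply/(primitiveP n0); case; exists W, i. Qed.

(** Curling numbers do not increase from a sequence to its suffixes, so the
    longest proper suffix decides robustness. *)
Lemma robust_behead k Y : 0 < k -> Y <> [::] ->
  robust k Y = (cn (behead (power k.+1 Y)) <= k).
Proof.
move=> k0 Y0; apply/forallP/idP => [/=|leb i].
  have lt1 : 1 < (size (power k.+1 Y)).+1.
    by rewrite size_power; move/nonempty_size: Y0; nia.
  by move/(_ (Ordinal lt1)); rewrite -leqNgt /= drop1.
apply/implyP; case: i => [[|i] lti] //= _; rewrite -leqNgt.
apply: leq_trans leb; rewrite -[i.+1]addn1 -drop_drop drop1.
by rewrite -{2}(cat_take_drop i (behead _)) cn_suffix.
Qed.

(** Given robustness, the curling number of [Y^(k+1)] is [k+1], being at least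
    [k+1] and at most one more than that of the tail. Conversely, a
    factorization [Y = X^i] would raise it to [(k+1)i]. *)
Lemma jump_power k Y : 0 < k -> Y <> [::] ->
  (cn (power k.+1 Y) == k.+1) && (cn (behead (power k.+1 Y)) == k)
  = primitive Y && robust k Y.
Proof.
move=> k0 Y0; rewrite robust_behead //.
have lek := power_pred_behead k _ Y0.
have lekS : k < cn (power k.+1 Y) by apply/leq_cnP => //; exists [::], Y.
have leS := cn_leq_behead (power k.+1 Y).
apply/andP/andP => -[].
  move=> /eqP eqS /eqP eqb; split; last by rewrite eqb.
  apply/(primitiveP Y0); case=> X [i [i1 defY]].
  have X0 : X <> [::].
    apply/nonempty_size; case/nonempty_size: (Y0); rewrite defY size_power.
    by case: (size X) => //; rewrite muln0.
  have : k.+1 * i <= cn (power k.+1 Y).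
    by apply/leq_cnP; [lia | exists [::], X; rewrite defY powerM].
  by rewrite eqS; nia.
move=> _ leb; split; apply/eqP; lia.
Qed.

(** A power [Z^(k+1)] inside a proper suffix of [Y^(k+1)] would satisfy
    [|Z| < |Y| < |Z^k|]. Comparing suffixes of [Y^(k+1)], both [YZ] and [ZY]
    occur at its end, so they are equal. *)
Lemma primitive_robust k Y :
  Y <> [::] -> primitive Y -> cn Y < k -> robust k Y.
Proof.
move=> Y0 primY ltk; have k0 : 0 < k by lia.
rewrite robust_behead // leqNgt; apply/negP.
case/leq_cnP=> // X [Z [Z0 defb]].
have {X defb} [X X0 defYk] :
    exists2 X, 0 < size X & power k.+1 Y = X ++ power k.+1 Z.
  exists (take 1 (power k.+1 Y) ++ X).
    by rewrite size_cat; case: (Y) Y0.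
  by rewrite -catA -defb -drop1 cat_take_drop.
have ltZY : size Z < size Y.
  have := congr1 size defYk; rewrite size_cat !size_power; nia.
(* Otherwise [Z^k] would be a suffix of [Y], against [cn Y < k]. *)
have ltYZ : size Y < size (power k Z).
  rewrite ltnNge; apply/negP => leZY.
  have [|V defY] := suffix_suffix (X ++ Z) (power k Y) _ _ _ leZY.
    by rewrite -catA -powerS -defYk powerSr.
  suff : k <= cn Y by rewrite leqNgt ltk.
  by apply/leq_cnP => //; exists V, Z.
(* [Y] ends [Z^k], so [YZ] ends [Z^(k+1)]; and [Z] ends [Y], so [ZY] ends
   [Y^2]. *)
have [|V defV] := suffix_suffix (power k Y) (X ++ Z) _ _ _ (ltnW ltYZ).
  by rewrite -catA -powerS -defYk powerSr.
have [|U defU] := suffix_suffix (X ++ power k Z) (power k Y) Z Y _ (ltnW ltZY).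
  by rewrite -catA -!powerSr.
have eqYZ : Y ++ Z = Z ++ Y.
  apply: (suffix_size_inj (X ++ V) (power k.-1 Y ++ U)).
    have defk : power k Y = power k.-1 Y ++ Y by rewrite -powerSr prednK.
    rewrite -!catA (catA V) -defV -powerSr -defYk powerSr defk.
    by rewrite (catA U) -defU catA.
  by rewrite !size_cat addnC.
have [W [i [j [defY defZ]]]] := commuting_words _ _ eqYZ.
have i1 : 1 < i.
  move: ltZY; move/nonempty_size: Z0; rewrite defY defZ !size_power.
  by rewrite muln_gt0 => /andP[j0 W0]; rewrite ltn_pmul2r //; apply: leq_ltn_trans.
by move: primY; rewrite defY; apply/negP/power_gt1_not_primitive; rewrite -?defY.
Qed.

Lemma robust_cn_leq k Y : 0 < k -> Y <> [::] -> robust k Y -> cn Y <= k.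
Proof.
move=> k0 Y0; rewrite robust_behead //; apply: leq_trans.
case: k k0 => // k _; rewrite powerSr.
by case: Y Y0 => // a Y _; rewrite /= -/(power _ _) -catA catA cn_suffix.
Qed.

End Words.

(** * Counting the sequences longer by one letter *)

Lemma card_letter : #|letter| = 2.
Proof. by rewrite card_seq_sub. Qed.

Lemma tuple_nonempty (A : eqType) m (Y : m.-tuple A) :
  0 < m -> tval Y <> [::].
Proof. by move=> m0; apply/nonempty_size; rewrite size_tuple. Qed.

Lemma card_behead (A : finType) n (Q : pred (seq A)) :
  #|[set S : n.+1.-tuple A | Q (behead S)]|
  = #|A| * #|[set S : n.-tuple A | Q S]|.
Proof.
rewrite -cardsT -cardsX.
pose f (u : A * n.-tuple A) := [tuple of u.1 :: u.2].
rewrite -(@card_imset _ _ f); last first.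
  by move=> [a S] [b U] /(congr1 val) [-> eqSU]; congr (_, _); apply: val_inj.
apply: eq_card => S; apply/idP/imsetP => [|[[a U]]].
  rewrite inE; case/tupleP: S => a U QU.
  by exists (a, U); rewrite ?inE //=; apply: val_inj.
by rewrite !inE /= => QU ->.
Qed.

(** The sequences whose curling number exceeds that of their tail; the excess is
    then one. *)
Definition jumps n k :=
  #|[set S : n.-tuple letter | (cn S == k.+1) && (cn (behead S) == k)]|.

(** Put in additive form to stay within the natural numbers. On sequences of
    length [n+1], both sides count those whose tail has curling number [k],
    together with those that reach [k] from a tail at [k-1]. *)
Lemma c_recursion n k : 0 < k ->
  c n.+1 k + jumps n.+1 k = 2 * c n k + jumps n.+1 k.-1.
Proof.
case: k => // k _; rewrite /c -card_letter.
rewrite -(card_behead _ n (fun S => cn S == k.+1)) /jumps /=.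
set B := [set S : n.+1.-tuple letter | cn (behead S) == k.+1].
set C := [set S : n.+1.-tuple letter | cn S == k.+1].
rewrite -(cardsID B C) -(cardsID C B) setIC -!addnA; congr (_ + _).
have ltE a b i : b <= a <= b.+1 ->
    ((a == i.+1) && (b == i) = (a != i) && (b == i))
  * ((b != i.+1) && (a == i.+1) = (a == i.+1) && (b == i)) by split; lia.
have cnS S := introT andP (conj (cn_behead letter S) (cn_leq_behead _ S)).
by rewrite addnC; congr (_ + _); apply: eq_card => S; rewrite !inE (ltE _ _ _ (cnS S)).
Qed.

(** * Evaluating the number of jumps *)

Lemma jumps_dvdn n k : 0 < n -> ~~ (k.+1 %| n) -> jumps n k = 0.
Proof.
move=> n0 ndvd; apply: eq_card0 => S; rewrite !inE; apply/negP.
case/andP=> /eqP eqS /eqP eqb.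
have [|Y _ defS] := @cn_jump_power _ S k.+1; first by rewrite eqS eqb !leqnn.
case/negP: ndvd; apply/dvdnP; exists (size Y).
by rewrite -(size_tuple S) defS size_power mulnC.
Qed.

(** A nonempty tail has a positive curling number. *)
Lemma jumps0 n : 1 < n -> jumps n 0 = 0.
Proof.
move=> n1; apply: eq_card0 => S; rewrite !inE; apply/negP => /andP[_ /eqP eqb].
have := cn_gt0 _ (behead S); rewrite eqb size_behead size_tuple; lia.
Qed.

(** The bijection is [Y |-> Y^(k+1)]. *)
Lemma jumps_mul m k : 0 < m -> 0 < k ->
  jumps (m * k.+1) k
  = #|[set Y : m.-tuple letter | primitive Y && robust k Y]|.
Proof.
move=> m0 k0.
have szP (Y : m.-tuple letter) : size (power k.+1 Y) == m * k.+1.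
  by rewrite size_power size_tuple mulnC.
rewrite -(@card_imset _ _ (fun Y => Tuple (szP Y))); last first.
  move=> Y Z /(congr1 val) /= eqYZ; apply: val_inj => /=.
  by move/eqP: eqYZ; rewrite eqseq_cat ?size_tuple // => /andP[/eqP].
apply: eq_card => S; apply/idP/imsetP => [|[Y]]; last first.
  by rewrite !inE -(jump_power _ _ _ k0 (tuple_nonempty _ _ Y m0)) => jY ->.
rewrite inE => jS.
have [|Y Y0 defS] := @cn_jump_power _ S k.+1.
  by case/andP: jS => /eqP-> /eqP->; rewrite !leqnn.
have szY : size Y == m.
  have := congr1 size defS; rewrite size_power size_tuple => /eqP.
  by rewrite mulnC eqn_pmul2l // eq_sym.
exists (Tuple szY); last exact: val_inj.
by rewrite inE -jump_power // -defS.
Qed.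

Lemma q_card m k : 0 < m ->
  q m k = #|[set Y : m.-tuple letter | primitive Y & cn Y <= k]|.
Proof.
move=> m0; elim: k => [|k IHk].
  rewrite q0; apply/esym/eq_card0 => Y; rewrite !inE leqn0.
  by have := cn_gt0 _ Y; rewrite size_tuple m0; lia.
rewrite /q big_nat_recr //= -/(q m k) IHk /p /P -cardsUI.
rewrite [X in _ + X]eq_card0 ?addn0 => [|Y]; last by rewrite !inE; lia.
by apply: eq_card => Y; rewrite !inE; case: primitive => /=; lia.
Qed.

(** Robust words have curling number at most [k]; below [k], robustness comes for
    free from primitivity. *)
Lemma card_primitive_robust m k : 0 < m -> 0 < k ->
  #|[set Y : m.-tuple letter | primitive Y && robust k Y]|
  = p' m k + q m k.-1.
Proof.
move=> m0 k0; rewrite q_card // /p' -cardsUI.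
rewrite [X in _ + X]eq_card0 ?addn0 => [|Y]; last by rewrite !inE; lia.
apply: eq_card => Y; rewrite !inE.
have Y0 := tuple_nonempty _ _ Y m0.
have := robust_cn_leq _ _ _ k0 Y0; have := primitive_robust _ k Y Y0.
case: primitive => //=; case: robust => /= [_ /(_ isT)|/(_ isT)]; lia.
Qed.

Lemma jumps_count n k : k.+1 < n ->
  jumps n k = (k.+1 %| n) * (p' (n %/ k.+1) k + q (n %/ k.+1) k.-1).
Proof.
move=> ltkn; case: (boolP (k.+1 %| n)) => [/dvdnP[m defn]|]; last first.
  by move=> ndvd; rewrite jumps_dvdn //; lia.
rewrite mul1n defn mulnK //; have m0 : 0 < m by move: defn; case: m; lia.
case: (posnP k) => [k0|k0]; last by rewrite jumps_mul // card_primitive_robust.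
by rewrite k0 jumps0 ?q0 ?p'_out //; lia.
Qed.

(** Here [Y] ranges over the single letters. These are primitive, and robust
    because a proper suffix of a word of length [n+2] is too short to have
    curling number [n+2]. *)
Lemma jumps_diag n : jumps n.+2 n.+1 = 2.
Proof.
rewrite -[n.+2]mul1n jumps_mul // -card_letter -[RHS]expn1 -card_tuple -cardsT.
apply: eq_card => Y; rewrite !inE; have Y0 := tuple_nonempty _ _ Y (ltn0Sn 0).
have -> : primitive Y.
  apply/(primitiveP Y0); case=> X [i [i1 /(congr1 size)]].
  rewrite size_tuple size_power => /esym/eqP; rewrite muln_eq1 => /andP[/eqP i_eq1 _].
  by rewrite i_eq1 in i1.
rewrite robust_behead //; apply: leq_trans (cn_leq_size _ _) _.
by rewrite size_behead size_power size_tuple muln1.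
Qed.

(** * Initial values and the recursion *)

Lemma c_gt n k : n < k -> c n k = 0.
Proof.
move=> ltnk; apply: eq_card0 => S; rewrite !inE; apply/negP => /eqP eqS.
by have := cn_leq_size _ S; rewrite eqS size_tuple; lia.
Qed.

(** With [c(n-1, n) = 0], the recursion leaves only the jumps to [n], made by the
    constant words; it starts from length one. *)
Lemma c_diag n : c n.+1 n.+1 = 2.
Proof.
case: n => [|n]; last first.
  have := c_recursion n.+1 n.+2 isT; rewrite (c_gt n.+1) //= jumps_diag.
  suff -> : jumps n.+2 n.+2 = 0 by lia.
  by rewrite jumps_dvdn //; apply/negP => /dvdn_leq; lia.
rewrite /c -card_letter -[RHS]expn1 -card_tuple -cardsT.
apply: eq_card => S; rewrite !inE.
by have := cn_leq_size _ S; have := cn_gt0 _ S; rewrite size_tuple; lia.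
Qed.

(** Each of the two words counted by [c_diag] has two extensions by a letter, of
    which one raises the curling number; no other word reaches it by a jump. *)
Lemma c_subdiag n : c n.+2 n.+1 = 2.
Proof.
have := c_recursion n.+1 n.+1 isT; rewrite c_diag jumps_diag /=.
suff -> : jumps n.+2 n = 0 by lia.
case: n => [|n]; first by rewrite jumps0.
by rewrite jumps_dvdn // -(addn1 n.+2) dvdn_addr // dvdn1.
Qed.

Local Open Scope ring_scope.

Theorem theorem8 (k n : nat) (hk : (1 <= k)%N) (hn : (1 <= n)%N) :
  [/\ (n <= k - 1)%N -> c n k = 0%N,
      n = k \/ n = (k + 1)%N -> c n k = 2%N
    & (k + 2 <= n)%N ->
      (c n k)%:Z =
        2%:Z * (c (n - 1) k)%:Z
        + (k %| n)%N%:Z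
            * ((p' (n %/ k) (k - 1))%:Z + (q (n %/ k) (k - 2))%:Z)
        - (k + 1 %| n)%N%:Z
            * ((p' (n %/ (k + 1)) k)%:Z + (q (n %/ (k + 1)) (k - 1))%:Z)].
Proof.
case: k hk => // k _; split=> [lenk|[->|->]|lekn].
- by apply: c_gt; lia.
- exact: c_diag.
- by rewrite addn1 c_subdiag.
case: n hn lekn => // n _ lekn.
have := c_recursion n k.+1 isT.
rewrite !jumps_count; try lia.
rewrite /= addn1 !subn1 subn2 /= => rec.
rewrite -!PoszD -!PoszM; lia.
Qed.
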